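(* Let $G\ne K_n$ be a graph on $n$ vertices. Then $$\dim_2^J(G)=\begin{cases}\dim_2^E(G) & \text{if } \mathcal R(G)=1/\sqrt2,\\ n-1 & \text{if } \mathcal R(G)>1/\sqrt2.\end{cases}$$
   Context: All graphs are finite and simple; $K_n$ is the complete graph on $n$ vertices. A Euclidean representation of a graph $G$ in $\mathbb R^d$ (as a two-distance set) is an injective map $f:V(G)\to\mathbb R^d$ for which there are real numbers $b\ge a>0$ with $\|f(u)-f(v)\|=a$ if $uv$ is an edge of $G$ and $\|f(u)-f(v)\|=b$ if $u\ne v$ and $uv$ is not an edge. The number $\dim_2^E(G)$ is the smallest $d$ such that $G$ has a Euclidean representation in $\mathbb R^d$. A J-spherical representation of $G$ in $\mathbb R^d$ is a Euclidean representation with $a=\sqrt2$ (and some $b\ge\sqrt2$) whose image affinely spans $\mathbb R^d$ and lies on the unit sphere $\mathbb S^{d-1}\subset\mathbb R^d$ centered at the origin. Every $G\neq K_n$ has such a representation, unique up to isometry; its dimension $d$ is denoted $\dim_2^J(G)$. For $G$ with vertices $v_1,\dots,v_n$ let $D_G(t)$ be the symmetric $n\times n$ matrix with zero diagonal whose $(i,j)$ entry ($i\neq j$) is $1$ if $v_iv_j$ is an edge and $t$ otherwise. Put $M_G(t)=\det D_G(t)$ and let $C_G(t)=\det\begin{pmatrix}0&\mathbf 1^T\\ \mathbf 1&D_G(t)\end{pmatrix}$, where $\mathbf 1$ is the all-ones column of length $n$. Let $F_G(t)=-\frac12\,\frac{M_G(t)}{C_G(t)}$, viewed as a rational function (common factors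 cancelled; $F_G(t_0)<\infty$ means that $t_0$ is not a pole). Let $\tau_1(G)$ be the smallest real root of $C_G$ that is $>1$, and $\tau_1(G)=\infty$ if there is no such root. If $\tau_1(G)<\infty$ and $F_G(\tau_1(G))<\infty$, put $\mathcal R(G)=\sqrt{F_G(\tau_1(G))}$; otherwise $\mathcal R(G)=\infty$. (One always has $\mathcal R(G)\ge1/\sqrt2$.) *)

(* Defs.v *)
From HB Require Import structures.
From mathcomp Require Import all_boot all_order all_algebra.
From mathcomp Require Import boolp classical_sets reals constructive_ereal.

Set Implicit Arguments.
Unset Strict Implicit.
Unset Printing Implicit Defensive.

Import Order.TTheory GRing.Theory Num.Theory.
Local Open Scope ring_scope.

Record sgraph (n : nat) := SGraph {
  adj : rel 'I_n;
  adj_sym : symmetric adj;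
  adj_irrefl : irreflexive adj
}.

Definition is_complete n (G : sgraph n) : Prop :=
  forall u v : 'I_n, adj G u v = (u != v).

Section Representations.
Variables (R : realType) (n : nat) (G : sgraph n).

(* Row vectors carry the sup norm in the library, hence this Euclidean norm. *)
Definition enorm d (x : 'rV[R]_d) : R := Num.sqrt (\sum_i x 0 i ^+ 2).

Definition two_distance_rep d (a b : R) (f : 'I_n -> 'rV[R]_d) : Prop :=
  [/\ injective f, 0 < a, a <= b,
      forall u v, adj G u v -> enorm (f u - f v) = a
    & forall u v, u != v -> ~~ adj G u v -> enorm (f u - f v) = b].

Definition has_euclidean_rep d : Prop :=
  exists (a b : R) (f : 'I_n -> 'rV[R]_d), two_distance_rep a b f.

Definition dim2E : nat :=
  xget 0%N [set d | has_euclidean_rep d /\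
                    forall d', has_euclidean_rep d' -> (d <= d')%N]%classic.

Definition affinely_spans d (f : 'I_n -> 'rV[R]_d) : Prop :=
  forall x : 'rV[R]_d, exists c : 'I_n -> R,
    \sum_i c i = 1 /\ x = \sum_i c i *: f i.

Definition has_Jspherical_rep d : Prop :=
  exists (b : R) (f : 'I_n -> 'rV[R]_d),
    [/\ two_distance_rep (Num.sqrt 2) b f,
        affinely_spans f
      & forall u, enorm (f u) = 1].

(* At most one d qualifies, and one does unless G is complete. *)
Definition dim2J : nat := xget 0%N [set d | has_Jspherical_rep d]%classic.

(* D_G(t) with the indeterminate 'X for t. *)
Definition distmx : 'M[{poly R}]_n :=
  \matrix_(i, j) if i == j then 0 else if adj G i j then 1 else 'X.

Definition detM : {poly R} := \det distmx.

Definition detC : {poly R} :=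
  \det (block_mx (0 : 'M_1) (const_mx 1) (const_mx 1) distmx).

(* Numerator and denominator of M_G / C_G with common factors cancelled. *)
Definition redM : {poly R} := detM %/ gcdp detM detC.
Definition redC : {poly R} := detC %/ gcdp detM detC.

(* F_G(t), with value +oo at the poles of the rational function F_G. *)
Definition ratF (t : R) : \bar R :=
  if root redC t then +oo%E else (- (1 / 2) * (redM.[t] / redC.[t]))%:E.

Definition is_smallest_root_gt1 (t : R) : Prop :=
  [/\ root detC t, 1 < t & forall s, root detC s -> 1 < s -> t <= s].

Definition tau1 : \bar R :=
  xget +oo%E [set t%:E | t in [set t | is_smallest_root_gt1 t]]%classic.

Definition calR : \bar R :=
  match tau1 with
  | t%:E => match ratF t with r%:E => (Num.sqrt r)%:E | _ => +oo end
  | _ => +oo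
  end%E.

End Representations.

(* Main.v *)
Require Import Defs.
From mathcomp Require Import all_boot all_order all_algebra.
From mathcomp Require Import zify ring lra.
From mathcomp Require Import boolp classical_sets reals constructive_ereal.

Import Order.TTheory GRing.Theory Num.Theory.
Local Open Scope ring_scope.

Set Implicit Arguments.
Unset Strict Implicit.

(** Write t = 1 + s for the ratio b^2 / a^2 of the squared distances, B for the
    adjacency matrix of the complement of G, and A(s) = I - s B, which is
    J - D_G(1 + s). Let H be the hyperplane of vectors with sum zero. On H the
    form of A(s) is, up to scale, the Gram form of any set of points realizing
    the distances, so a Euclidean representation with parameter s exists exactly
    when A(s) is semidefinite on H, and its affine dimension is the rank of the
    form there. Placing the points on the unit sphere with a^2 = 2 makes A(s)
    itself the Gram matrix; the sphere has the dimension of the affine span only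
    if the origin is an affine combination of the points, that is, if A(s) is
    semidefinite and has a kernel vector of sum 1.

    This determines s: a form I - s B that vanishes at a nonzero vector for some
    s > 0 becomes negative there for every larger s (isotropic_decreases), so s is
    the last parameter sigma at which A is semidefinite. A Perron-Frobenius argument
    provides the kernel vector of sum 1 at sigma (spherical_kernel_exists), and
    dim_2^J(G) = rank A(sigma) (dim2J_eq). In the same way tau_1 - 1 is the last
    parameter at which A is semidefinite on H (is_smallest_root_psd,
    psd_on_hyperplane_tau), because C_G(1 + s) vanishes exactly when the form on H
    is degenerate (root_detC).

    The two parameters are compared through F_G. The identity
    M_G + C_G = det (D_G - J) gives F_G - 1/2 = - det (D_G - J) / (2 C_G), so
    R(G) = 1/sqrt 2 says that det (D_G - J) vanishes to a higher order than C_G at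
    tau_1 (reduced_fraction_eqN1, calR_half). Both are determinants of
    symmetric linear pencils, and the multiplicity of such a root is the dimension
    of the kernel (mup_det_pencil). Hence the condition on orders compares ker A
    with the kernel of the form on H at tau_1. If ker A is contained in H, it is
    contained in that second kernel; so a larger order forces ker A to leave H,
    and then A is semidefinite on the whole space (kernel_of_mup_lt,
    psd_of_kernel). Conversely, if A is semidefinite with a kernel vector outside
    H, the second kernel is the intersection of ker A with H, which is strictly
    smaller (mup_lt_of_psd). So R(G) = 1/sqrt 2 means that tau_1 - 1 = sigma.

    In that case the spherical representation is also a Euclidean one of least
    dimension (euclidean_rank_le). Otherwise ker A(sigma) is a line: two independent
    kernel vectors would combine to one in H, making 1 + sigma a root of C_G and
    hence equal to tau_1. So rank A(sigma) = n - 1. *)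

(** * Positive semidefinite forms *)

Section Forms.
Variable (R : realType).

Definition bil n (A : 'M[R]_n) (x y : 'rV[R]_n) : R := (x *m A *m y^T) 0 0.

Definition psd n (A : 'M[R]_n) := forall x, 0 <= bil A x x.

Section Basic.
Variables (n : nat).
Implicit Types (A B : 'M[R]_n) (x y z : 'rV[R]_n).

Lemma bilDl A x y z : bil A (x + y) z = bil A x z + bil A y z.
Proof. by rewrite /bil !mulmxDl mxE. Qed.

Lemma bilZl A c x z : bil A (c *: x) z = c * bil A x z.
Proof. by rewrite /bil -!scalemxAl mxE. Qed.

Lemma bilDr A x y z : bil A z (x + y) = bil A z x + bil A z y.
Proof. by rewrite /bil linearD mulmxDr mxE. Qed.

Lemma bilZr A c x z : bil A z (c *: x) = c * bil A z x.
Proof. by rewrite /bil linearZ -scalemxAr mxE. Qed.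

Lemma bilC A x y : A^T = A -> bil A x y = bil A y x.
Proof.
move=> symA; rewrite /bil; transitivity ((x *m A *m y^T)^T 0 0).
  by rewrite [RHS]mxE.
by rewrite !trmx_mul trmxK symA mulmxA.
Qed.

Lemma bilE A x y : bil A x y = \sum_i \sum_j x 0 i * A i j * y 0 j.
Proof.
rewrite /bil mxE exchange_big; apply: eq_bigr => j _.
by rewrite !mxE mulr_suml.
Qed.

Lemma bil_delta A x j : bil A x (delta_mx 0 j) = (x *m A) 0 j.
Proof. by rewrite /bil trmx_delta -colE mxE. Qed.

Lemma bil_ext A x : (forall y, bil A x y = 0) -> x *m A = 0.
Proof. by move=> h; apply/rowP=> j; rewrite -bil_delta h mxE. Qed.

Lemma bil_pencil A B s x y : bil (A - s *: B) x y = bil A x y - s * bil B x y.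
Proof. by rewrite /bil mulmxBr mulmxBl -scalemxAr -scalemxAl !mxE. Qed.

Lemma bil1E x y : bil 1%:M x y = \sum_i x 0 i * y 0 i.
Proof. by rewrite /bil mulmx1 mxE; apply: eq_bigr => i _; rewrite mxE. Qed.

Lemma bil1_ge0 x : 0 <= bil 1%:M x x.
Proof. by rewrite bil1E sumr_ge0 // => i _; rewrite -expr2 sqr_ge0. Qed.

Lemma bil1_eq0 x : bil 1%:M x x = 0 -> x = 0.
Proof.
rewrite bil1E => /eqP; rewrite psumr_eq0; last by move=> i _; rewrite -expr2 sqr_ge0.
move=> /allP h; apply/rowP => i; apply/eqP.
by have := h i (mem_index_enum i); rewrite mxE /= -expr2 sqrf_eq0.
Qed.

Lemma bil1_gt0 x : x != 0 -> 0 < bil 1%:M x x.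
Proof.
by move=> x0; rewrite lt_def bil1_ge0 andbT; apply: contra x0 => /eqP/bil1_eq0->.
Qed.

Lemma bil_congr m (N : 'M[R]_(m, n)) A (x y : 'rV[R]_m) :
  bil (N *m A *m N^T) x y = bil A (x *m N) (y *m N).
Proof. by rewrite /bil trmx_mul !mulmxA. Qed.

Lemma trmx_congr m (N : 'M[R]_(m, n)) A : (N *m A *m N^T)^T = N *m A^T *m N^T.
Proof. by rewrite !trmx_mul trmxK mulmxA. Qed.

Lemma cauchy_schwarz A x y : A^T = A -> psd A ->
  bil A x y ^+ 2 <= bil A x x * bil A y y.
Proof.
move=> symA psdA; set p := bil A x x; set q := bil A x y; set r := bil A y y.
have p0 : 0 <= p := psdA x.
have E c d : 0 <= c ^+ 2 * p + 2 * c * d * q + d ^+ 2 * r.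
  have := psdA (c *: x + d *: y).
  rewrite bilDl !bilDr !bilZl !bilZr (bilC y x symA) -/p -/q -/r => h.
  by apply: le_trans h _; rewrite le_eqVlt; apply/orP; left; apply/eqP; ring.
have [pz|pn] := eqVneq p 0.
  rewrite pz mul0r; have [->|qn] := eqVneq q 0; first by rewrite expr0n.
  (* For p = 0 the form at c x + y is affine in c; this c gives it the value -1. *)
  have := E (- (r + 1) / (2 * q)) 1.
  rewrite pz => h; have : 0 <= -1 :> R by apply: le_trans h _;
    rewrite le_eqVlt; apply/orP; left; apply/eqP; field.
  by rewrite ler0N1.
have pp : 0 < p by rewrite lt_def pn.
(* p y - q x is p times the point of the line y + R x where the form is least. *)
have h := E (- q) p; rewrite -subr_ge0 -(pmulr_rge0 (_ - _) pp).
by apply: le_trans h _; rewrite le_eqVlt; apply/orP; left; apply/eqP; ring.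
Qed.

Lemma psd_isotropic A x : A^T = A -> psd A -> bil A x x = 0 -> x *m A = 0.
Proof.
move=> symA psdA x0; apply: bil_ext => y; apply/eqP.
rewrite -sqrf_eq0 eq_le sqr_ge0 andbT.
by apply: le_trans (cauchy_schwarz x y symA psdA) _; rewrite x0 mul0r.
Qed.

(** The constant exceeds the sum of the absolute values of the entries by 1 only
    to make it positive. *)
Lemma bil_bound B : exists2 b, 0 < b & forall x, bil B x x <= b * bil 1%:M x x.
Proof.
exists (1 + \sum_i \sum_j `|B i j|) => [|x].
  by rewrite ltr_wpDr // sumr_ge0 // => i _; rewrite sumr_ge0.
have xi i : x 0 i ^+ 2 <= bil 1%:M x x.
  rewrite bil1E (bigD1 i) //= -expr2 lerDl sumr_ge0 // => j _.
  by rewrite -expr2 sqr_ge0.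
rewrite mulrDl mul1r; apply: ler_wpDl; first exact: bil1_ge0.
rewrite bilE mulr_suml; apply: ler_sum => i _; rewrite mulr_suml.
apply: ler_sum => j _; apply: le_trans (ler_norm _) _.
rewrite mulrAC normrM mulrC ler_wpM2l // ler_norml.
by have := xi i; have := xi j; nra.
Qed.

(** Cauchy-Schwarz for A, applied to x and x A^-1, bounds |x|^4 by
    (x A x^T)(x A^-1 x^T): no compactness is needed for a positive lower bound
    on the sphere. *)
Lemma psd_coercive A : A^T = A -> psd A -> A \in unitmx ->
  exists2 c, 0 < c & forall x, c * bil 1%:M x x <= bil A x x.
Proof.
move=> symA psdA uA; have [b b0 hb] := bil_bound (invmx A).
exists b^-1 => [|x]; first by rewrite invr_gt0.
rewrite mulrC ler_pdivrMr //.
have [->|x0] := eqVneq x 0; first by rewrite /bil !mul0mx !mxE mul0r.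
have := cauchy_schwarz x (x *m invmx A) symA psdA.
have symV : (invmx A)^T = invmx A by rewrite trmx_inv symA.
have -> : bil A x (x *m invmx A) = bil 1%:M x x.
  by rewrite /bil trmx_mul symV !mulmxA mulmxK // mulmx1.
have -> : bil A (x *m invmx A) (x *m invmx A) = bil (invmx A) x x.
  by rewrite /bil trmx_mul symV mulmxKV // mulmxA.
move=> h; rewrite -(ler_pM2r (bil1_gt0 x0)) -expr2 -mulrA.
by apply: le_trans h _; rewrite ler_wpM2l.
Qed.

(** The supremum of the parameters at which the pencil is semidefinite is
    attained; the form there has a kernel, since a nonsingular one would be
    coercive and stay semidefinite a little further. *)
Lemma pencil_degenerates A B s1 : A^T = A -> B^T = B -> psd A -> 0 <= s1 ->
  ~ psd (A - s1 *: B) ->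
  exists s, [/\ 0 <= s, s < s1, psd (A - s *: B)
    & exists2 x : 'rV_n, x != 0 & x *m (A - s *: B) = 0].
Proof.
move=> symA symB psdA s1_ge0 npsd.
pose S : set R := [set s | 0 <= s <= s1 /\ psd (A - s *: B)]%classic.
have S0 : S 0 by split; [rewrite lexx | rewrite scale0r subr0].
have Sub : ubound S s1 by move=> s [/andP[]].
have hS : has_sup S by split; [exists 0 | exists s1].
pose s := sup S.
have s_ge0 : 0 <= s by apply: ub_le_sup => //; exists s1.
have s_le : s <= s1 by apply: ge_sup => //; exists 0.
have psds : psd (A - s *: B).
  move=> x; rewrite bil_pencil leNgt; apply/negP => neg.
  have a0 := psdA x.
  have b0 : 0 < bil B x x.
    by rewrite ltNge; apply/negP => b0; have : s * bil B x x <= 0;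
       [rewrite mulr_ge0_le0 | lra].
  (* Every admissible parameter, hence their supremum, is at most this ratio. *)
  suff : s <= bil A x x / bil B x x by rewrite ler_pdivlMr //; lra.
  apply: ge_sup; first by exists 0.
  move=> u [_ /(_ x)]; rewrite bil_pencil ler_pdivlMr //; lra.
have s_lt : s < s1.
  by rewrite lt_neqAle s_le andbT; apply/eqP => E; apply: npsd; rewrite -E.
exists s; split => //; apply: contrapT => nx.
have symP : (A - s *: B)^T = A - s *: B by rewrite linearB linearZ /= symA symB.
have uP : A - s *: B \in unitmx.
  rewrite unitmxE unitfE; apply/det0P => -[x x0 hx]; apply: nx; by exists x.
have [c c0 hc] := psd_coercive symP psds uP.
have [b b0 hb] := bil_bound B.
(* A step e with e b <= c costs less than the coercivity constant c. *)
pose e := Num.min (c / b) (s1 - s).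
have e0 : 0 < e by rewrite lt_min divr_gt0 //= subr_gt0.
have : S (s + e).
  split; first by rewrite addr_ge0 ?(ltW e0) //= -lerBrDl ge_min lexx orbT.
  move=> x; rewrite bil_pencil; have := hc x; rewrite bil_pencil.
  have := hb x; have : e * b <= c by rewrite -ler_pdivlMr // ge_min lexx.
  have := bil1_ge0 x; nra.
move=> /(ub_le_sup (ex_intro _ s1 Sub)); rewrite -/s; lra.
Qed.

End Basic.

(** Peeling off the rank-one form of row i, where A i i > 0, puts the i-th unit
    vector in the kernel without losing any kernel vector, so the rank drops. *)
Lemma psd_gram_le n m (A : 'M[R]_n) : A^T = A -> psd A -> (\rank A <= m)%N ->
  exists F : 'M[R]_(n, m), A = F *m F^T.
Proof.
elim: m A => [|m IH] A symA psdA rA.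
  by exists 0; rewrite mul0mx; apply/eqP; rewrite -mxrank_eq0 -leqn0.
have [A0|An0] := eqVneq A 0; first by exists 0; rewrite mul0mx.
have [i Ai] : exists i, 0 < A i i.
  apply: contrapT => nA; move/eqP: An0; apply.
  apply/row_matrixP => i; rewrite row0 rowE; apply: psd_isotropic => //.
  apply/eqP; rewrite eq_le psdA andbT leNgt bil_delta -rowE mxE.
  by apply/negP => ?; apply: nA; exists i.
pose v : 'cV[R]_n := (Num.sqrt (A i i))^-1 *: col i A.
have vv : v *m v^T = (A i i)^-1 *: (col i A *m row i A).
  rewrite /v linearZ /= -scalemxAl -scalemxAr scalerA -invfM -expr2 sqr_sqrtr ?ltW //.
  by rewrite tr_col symA.
have symv : (v *m v^T)^T = v *m v^T by rewrite trmx_mul trmxK.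
pose A' := A - v *m v^T.
have symA' : A'^T = A' by rewrite /A' linearB /= symA symv.
have eA : (delta_mx 0 i : 'rV_n) *m A' = 0.
  rewrite /A' mulmxBr vv -scalemxAr mulmxA -[_ *m A]rowE.
  rewrite (_ : _ *m col i A = (A i i)%:M); last first.
    by rewrite -rowE; apply/matrixP => a b; rewrite !ord1 !mxE.
  by rewrite mul_scalar_mx scalerA mulVf ?gt_eqF // scale1r subrr.
have psdA' : psd A'.
  move=> x; have -> : bil A' x x = bil A x x - (A i i)^-1 * bil A x (delta_mx 0 i) ^+ 2.
    rewrite /bil /A' mulmxBr mulmxBl vv -scalemxAr -scalemxAl.
    rewrite [LHS]mxE [in X in _ + X]mxE; congr (_ + _); rewrite mxE; congr (- (_ * _)).
    rewrite -/(bil A x (delta_mx 0 i)); set u := x *m col i A.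
    have -> : x *m (col i A *m row i A) *m x^T = u *m u^T.
      by rewrite trmx_mul tr_col symA !mulmxA.
    rewrite bil_delta mxE big_ord1 expr2.
    by congr (_ * _); rewrite !mxE; apply: eq_bigr => j _; rewrite !mxE.
  rewrite subr_ge0 mulrC ler_pdivrMr //.
  apply: le_trans (cauchy_schwarz _ _ symA psdA) _.
  by rewrite bil_delta -rowE mxE.
have rA' : (\rank A' <= m)%N.
  rewrite -ltnS; apply: leq_trans rA.
  have kA : (kermx A < kermx A')%MS.
    rewrite /ltmx; apply/andP; split.
      apply/sub_kermxP; rewrite /A' mulmxBr vv mulmx_ker -scalemxAr mulmxA colE mulmxA.
      by rewrite mulmx_ker !mul0mx scaler0 subr0.
    apply/negP => /(submx_trans (introT sub_kermxP eA))/sub_kermxP.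
    rewrite -rowE => /rowP/(_ i); rewrite !mxE => E.
    by move: Ai; rewrite E ltxx.
  have := rank_ltmx kA; have := rank_leq_row A; have := rank_leq_row A'.
  rewrite !mxrank_ker; lia.
have [F' EF] := IH _ symA' psdA' rA'.
exists (row_mx v F' : 'M_(n, 1 + m)).
have := mul_row_col v F' v^T F'^T.
by rewrite -tr_row_mx -EF /A' addrC subrK.
Qed.

Lemma bil_gram n m (F : 'M[R]_(n, m)) x :
  bil (F *m F^T) x x = bil 1%:M (x *m F) (x *m F).
Proof. by rewrite /bil mulmx1 trmx_mul !mulmxA. Qed.

Lemma psd_mul_tr n m (F : 'M[R]_(n, m)) : psd (F *m F^T).
Proof. by move=> x; rewrite bil_gram bil1_ge0. Qed.

Lemma gram_ker n m (F : 'M[R]_(n, m)) (x : 'rV_n) :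
  x *m (F *m F^T) = 0 -> x *m F = 0.
Proof. by move=> h; apply: bil1_eq0; rewrite -bil_gram /bil h mul0mx mxE. Qed.

Lemma rank_gram n m (F : 'M[R]_(n, m)) : \rank (F *m F^T) = \rank F.
Proof.
apply/eqP; rewrite eqn_leq mxrankM_maxl.
have sK : (kermx (F *m F^T) <= kermx F)%MS.
  apply/row_subP => i; apply/sub_kermxP/gram_ker.
  by apply/sub_kermxP; rewrite row_sub.
have := mxrankS sK; rewrite !mxrank_ker.
have := rank_leq_row F; have := rank_leq_row (F *m F^T); lia.
Qed.

End Forms.

(** * Determinants of linear pencils *)

Section Pencil.
Variables (F : fieldType) (n : nat).

Definition polypencil (L0 L1 : 'M[F]_n) (t0 : F) : 'M[{poly F}]_n :=
  map_mx polyC L0 + ('X - t0%:P) *: map_mx polyC L1.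

Lemma horner_polypencil L0 L1 t0 t :
  (\det (polypencil L0 L1 t0)).[t] = \det (L0 + (t - t0) *: L1).
Proof.
rewrite -[LHS]/(horner_eval t _) -det_map_mx; congr (\det _).
by apply/matrixP => i j; rewrite !mxE /= /horner_eval !hornerE.
Qed.

(** In a basis whose last vectors span the kernel of L0, the corresponding rows
    of the pencil are divisible by X - t0. Dividing them, and evaluating at t0,
    leaves a matrix that is nonsingular because L1 has no isotropic vector in
    that kernel. *)
Lemma mup_det_pencil (L0 L1 : 'M[F]_n) (t0 : F) : L0^T = L0 ->
  (forall x : 'rV_n, x *m L0 = 0 -> (x *m L1 *m x^T) 0 0 = 0 -> x = 0) ->
  \det (polypencil L0 L1 t0) != 0 /\
  mup t0 (\det (polypencil L0 L1 t0)) = \rank (kermx L0).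
Proof.
move=> symL aniso.
pose r : nat := \rank L0; pose T : 'M[F]_n := invmx (col_ebase L0).
have uT : T \in unitmx by rewrite unitmx_inv col_ebase_unit.
have TL : T *m L0 = pid_mx r *m row_ebase L0.
  by rewrite -{1}[L0]mulmx_ebase -[col_ebase _ *m _ *m _]mulmxA mulKmx // col_ebase_unit.
have [P0 defP0] : exists P0, P0 = T *m L0 *m T^T by eexists.
have [P1 defP1] : exists P1, P1 = T *m L1 *m T^T by eexists.
have P0z (i j : 'I_n) : (r <= i)%N -> P0 i j = 0.
  move=> ri; have -> : P0 = pid_mx r *m (row_ebase L0 *m T^T).
    by rewrite defP0 TL mulmxA.
  rewrite mxE big1 // => k _; rewrite !mxE; case: eqP => [ik|]; last by rewrite mul0r.
  by rewrite ltnNge ri mul0r.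
pose q : {poly F} := 'X - t0%:P.
pose d : 'rV[{poly F}]_n := \row_i if (i < r)%N then 1 else q.
pose S0 : 'M[F]_n := \matrix_(i, j) if (i < r)%N then P0 i j else P1 i j.
pose S1 : 'M[F]_n := \matrix_(i, j) if (i < r)%N then P1 i j else 0.
have E : polypencil P0 P1 t0 = diag_mx d *m polypencil S0 S1 t0.
  apply/matrixP => i j; rewrite mul_diag_mx !mxE; case: ltnP => ri.
    by rewrite mul1r.
  by rewrite P0z // !polyC0 add0r mulr0 addr0.
have E2 : polypencil P0 P1 t0 =
    map_mx polyC T *m polypencil L0 L1 t0 *m map_mx polyC T^T.
  rewrite /polypencil mulmxDr mulmxDl -scalemxAr -scalemxAl.
  by rewrite -!map_mxM defP0 defP1.
have dd : \det (diag_mx d) = q ^+ (n - r).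
  rewrite det_diag (eq_bigr (fun i : 'I_n => if (i < r)%N then 1 else q)); last first.
    by move=> i _; rewrite mxE.
  rewrite -(big_mkord xpredT (fun i => if (i < r)%N then 1 else q)).
  rewrite (big_cat_nat (leq0n r) (rank_leq_row L0)) /=.
  rewrite big_nat big1 => [|i /andP[_ ->]//]; rewrite mul1r -prodr_const_nat.
  by rewrite big_nat [RHS]big_nat; apply: eq_bigr => i; move=> /andP[ri _]; rewrite ltnNge ri.
have S0n : \det S0 != 0.
  rewrite -det_tr; apply/det0P => -[w w0 hw].
  have hS : S0 *m w^T = 0 by rewrite -[S0]trmxK -trmx_mul hw trmx0.
  have h0 : P0 *m w^T = 0.
    apply/matrixP => i j; rewrite [RHS]mxE; have [ri|ri] := ltnP i r.
      have /matrixP/(_ i j) := hS; rewrite [in RHS]mxE => <-.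
      by rewrite !mxE; apply: eq_bigr => k _; rewrite [in RHS]mxE ri.
    by rewrite mxE big1 // => k _; rewrite P0z // mul0r.
  have wL : w *m T *m L0 = 0.
    have : L0 *m (w *m T)^T = 0.
      by apply: (can_inj (mulKmx uT)); rewrite trmx_mul mulmx0 !mulmxA -defP0.
    by move=> /(congr1 trmx); rewrite trmx_mul trmxK symL trmx0.
  have wr (i : 'I_n) : (i < r)%N -> w 0 i = 0.
    move=> ri; have : w *m pid_mx r = 0 :> 'rV_n.
      apply: (can_inj (mulmxK (row_ebase_unit L0))).
      by rewrite mul0mx -mulmxA -TL mulmxA.
    move=> /rowP/(_ i); rewrite !mxE (bigD1 i) //= mxE eqxx ri mulr1 big1 ?addr0 //.
    by move=> k ki; rewrite mxE -[(k == i :> nat)]/(k == i) (negPf ki) mulr0.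
  have : w *m T = 0.
    apply: aniso => //.
    have -> : w *m T *m L1 *m (w *m T)^T = w *m (P1 *m w^T).
      by rewrite defP1 trmx_mul !mulmxA.
    rewrite mxE.
    rewrite big1 // => i _; have [ri|ri] := ltnP i r; first by rewrite wr // mul0r.
    have /matrixP/(_ i 0) := hS; rewrite [in RHS]mxE => hi.
    rewrite (_ : (P1 *m w^T) i 0 = 0) ?mulr0 // -hi !mxE.
    by apply: eq_bigr => k _; rewrite [in RHS]mxE ltnNge ri.
  move=> /(congr1 (mulmx^~ (invmx T))); rewrite mulmxK // mul0mx => wz.
  by rewrite wz eqxx in w0.
have Sr : ~~ root (\det (polypencil S0 S1 t0)) t0.
  by rewrite /root horner_polypencil subrr scale0r addr0.
have dTn : \det T != 0 by rewrite -unitfE -unitmxE.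
have /(congr1 determinant) := E2; rewrite E !det_mulmx dd !det_map_mx det_tr => D.
have Cr : ~~ root (\det T)%:P t0 by rewrite /root hornerC.
split.
  apply: contraTneq isT => z; move/eqP: D; rewrite z mulr0 mul0r mulf_eq0.
  rewrite expf_eq0 polyXsubC_eq0 andbF /= => /eqP z2.
  by move: Sr; rewrite z2 root0.
have /(congr1 (mup t0)) := D.
by rewrite mupMl // mupMl // mupMr // mup_XsubCX eqxx mxrank_ker.
Qed.

End Pencil.

(** * The matrices of a graph *)

(** The determinant is affine in the corner entry of the bordered matrix: the
    corner 0 gives the Cayley-Menger determinant, and the corner 1 can be
    eliminated from the border, which leaves D - J. *)
Lemma det_border (K : comPzRingType) n (D : 'M[K]_n) :
  \det (D - const_mx 1) =
  \det D + \det (block_mx (0 : 'M_1) (const_mx 1) (const_mx 1) D).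
Proof.
have -> : \det (D - const_mx 1) =
    \det (block_mx (1%:M : 'M_1) (const_mx 1) (const_mx 1) D).
  have -> : block_mx (1%:M : 'M_1) (const_mx 1) (const_mx 1) D =
      block_mx (1%:M : 'M_1) 0 (const_mx 1) 1%:M *m
      block_mx 1%:M (const_mx 1) 0 (D - const_mx 1).
    rewrite mulmx_block !mul1mx !mulmx1 !mul0mx !addr0.
    congr block_mx; apply/matrixP => i j; rewrite !mxE big_ord1 !mxE mul1r; ring.
  by rewrite det_mulmx det_lblock det_ublock !det1 !mul1r.
have -> : \det D = \det (block_mx (1%:M : 'M_1) 0 (const_mx 1) D).
  by rewrite det_lblock det1 mul1r.
rewrite (@determinant_multilinear _ _ (block_mx (1%:M : 'M_1) (const_mx 1) (const_mx 1) D)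
  (block_mx (1%:M : 'M_1) 0 (const_mx 1) D)
  (block_mx (0 : 'M_1) (const_mx 1) (const_mx 1) D) (lshift n 0) 1 1).
- by rewrite !mul1r.
- rewrite !rowKu; apply/rowP => j; rewrite !mxE.
  by case: splitP => k _; rewrite !mxE ?mul1r ?mulr0 ?addr0 ?mulr1 ?add0r.
- apply/matrixP => i j; rewrite !mxE; case: splitP => //= k.
  by rewrite (ord1 k) /= /bump leq0n.
- apply/matrixP => i j; rewrite !mxE; case: splitP => //= k.
  by rewrite (ord1 k) /= /bump leq0n.
Qed.

Section Graph.
Variables (R : realType) (n : nat) (G : sgraph n).

Definition nonadj : 'M[R]_n := \matrix_(i, j) ((i != j) && ~~ adj G i j)%:R.

(** For vectors of norm 1 at squared distance 2 on edges and 2 (1 + s) on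
    non-edges, this is the Gram matrix; it equals J - D_G(1 + s). *)
Definition sphmx (s : R) : 'M[R]_n := 1%:M - s *: nonadj.

Definition ones : 'cV[R]_n := const_mx 1.

(** The Cayley-Menger matrix whose determinant is C_G(1 + s). *)
Definition bordmx (s : R) : 'M[R]_(1 + n) :=
  block_mx 0 ones^T ones (ones *m ones^T - sphmx s).

Lemma nonadj_sym : nonadj^T = nonadj.
Proof. by apply/matrixP => i j; rewrite !mxE eq_sym adj_sym. Qed.

Lemma sphmx_sym s : (sphmx s)^T = sphmx s.
Proof. by rewrite /sphmx linearB linearZ /= nonadj_sym trmx1. Qed.

Lemma sphmxE s i j :
  sphmx s i j = if i == j then 1 else if adj G i j then 0 else - s.
Proof.
rewrite !mxE; case: eqVneq => _ /=; first by rewrite mulr0 subr0.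
by case: adj; rewrite ?mulr0 ?subr0 ?mulr1 ?sub0r.
Qed.

Lemma sphmx0 : sphmx 0 = 1%:M.
Proof. by rewrite /sphmx scale0r subr0. Qed.

Lemma bil_sphmx s x y : bil (sphmx s) x y = bil 1%:M x y - s * bil nonadj x y.
Proof. exact: bil_pencil. Qed.

Lemma onesM : ones *m ones^T = const_mx 1.
Proof. by apply/matrixP => i j; rewrite mxE big_ord1 !mxE mulr1. Qed.

Lemma detC_pencil t0 : detC R G =
  \det (polypencil (bordmx (t0 - 1)) (block_mx 0 0 0 nonadj) t0).
Proof.
rewrite /detC; congr (\det _); rewrite /polypencil !map_block_mx.
rewrite scale_block_mx add_block_mx !map_mx0 !scaler0 !addr0.
congr block_mx; try by apply/matrixP => i j; rewrite !mxE.
rewrite onesM; apply/matrixP => i j; rewrite !mxE.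
case: eqVneq => _ /=; first by rewrite !mulr0 subr0 addr0 subrr.
case: adj => /=; first by rewrite !mulr0 !subr0 addr0.
by rewrite !mulr1 ?polyCD ?polyCN ?polyCD ?polyCN ?polyC1; ring.
Qed.

Lemma detMC_pencil t0 : Defs.detM R G + detC R G =
  \det (polypencil (- sphmx (t0 - 1)) nonadj t0).
Proof.
rewrite -det_border; congr (\det _); apply/matrixP => i j; rewrite !mxE.
case: eqVneq => _ /=; first by rewrite !mulr0 subr0 addr0 sub0r polyCN.
case: adj => /=; first by rewrite !mulr0 !subr0 oppr0 addr0 subrr.
by rewrite !mulr1 !polyCN ?polyCD ?polyCN ?polyC1; ring.
Qed.

Lemma bordmx_kernel s c (x : 'rV_n) : row_mx c x *m bordmx s = 0 <->
  x *m ones = 0 /\ x *m sphmx s = c *m ones^T.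
Proof.
rewrite mul_row_block mulmx0 add0r mulmxBr mulmxA; split.
  move=> /eqP; rewrite row_mx_eq0 => /andP[/eqP -> /eqP].
  by rewrite mul0mx add0r => /eqP; rewrite subr_eq0 => /eqP.
by move=> [-> ->]; rewrite mul0mx add0r subrr row_mx0.
Qed.

Definition singular_on_hyperplane (s : R) (x : 'rV[R]_n) :=
  [/\ x != 0, x *m ones = 0 & forall z, z *m ones = 0 -> bil (sphmx s) x z = 0].

Definition psd_on_hyperplane (s : R) :=
  forall x : 'rV[R]_n, x *m ones = 0 -> 0 <= bil (sphmx s) x x.

Hypothesis n_gt0 : (0 < n)%N.

Lemma mulmx_ones_eq0 (c : 'M[R]_1) : c *m ones^T = 0 -> c = 0.
Proof.
move=> /rowP/(_ (Ordinal n_gt0)); rewrite !mxE big_ord1 !mxE mulr1 => cc.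
by apply/rowP => j; rewrite ord1 cc mxE.
Qed.

Lemma orth_hyperplane (u : 'rV[R]_n) :
  (forall z : 'rV[R]_n, z *m ones = 0 -> u *m z^T = 0) ->
  exists c : 'M_1, u = c *m ones^T.
Proof.
move=> h; pose i0 := Ordinal n_gt0.
exists (u 0 i0)%:M; apply/rowP => i.
have /h/matrixP/(_ 0 0) : (delta_mx 0 i - delta_mx 0 i0 : 'rV[R]_n) *m ones = 0.
  by rewrite mulmxBl -!rowE; apply/rowP => j; rewrite !mxE subrr.
rewrite linearB /= mulmxBr !trmx_delta -!colE !mxE big_ord1 !mxE => /eqP.
by rewrite subr_eq0 mulr1 => /eqP.
Qed.

(** A kernel vector (c, x) of the Cayley-Menger matrix has x in the hyperplane
    and x A(s) proportional to the all-ones vector, which is orthogonality to the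
    hyperplane for the form A(s). *)
Lemma root_detC t : root (detC R G) t <-> exists x, singular_on_hyperplane (t - 1) x.
Proof.
rewrite /root (detC_pencil t) horner_polypencil subrr scale0r addr0.
split.
  move=> /det0P[v v0]; rewrite -[v]hsubmxK => /bordmx_kernel[xo cx].
  exists (rsubmx v); split => //.
    apply: contra v0 => /eqP x0; rewrite -[v]hsubmxK x0.
    move: cx; rewrite x0 mul0mx => /esym/mulmx_ones_eq0 ->.
    by rewrite row_mx0.
  by move=> z zo; rewrite /bil cx -mulmxA -trmx_mul zo trmx0 mulmx0 mxE.
move=> [x [x0 xo hx]]; apply/det0P.
have [z zo|c hc] := @orth_hyperplane (x *m sphmx (t - 1)).
  by apply/matrixP => i j; rewrite !ord1 [RHS]mxE; exact: (hx z zo).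
exists (row_mx c x); first by rewrite row_mx_eq0 negb_and x0 orbT.
exact/bordmx_kernel.
Qed.

Lemma singular_gt0 s x : 0 <= s -> singular_on_hyperplane s x -> 0 < s.
Proof.
move=> s0 [x0 xo hx]; rewrite lt_def s0 andbT; apply: contra x0 => /eqP sz.
by apply/eqP/bil1_eq0; have := hx x xo; rewrite sz sphmx0.
Qed.

(** Since |x|^2 = s x B x^T > 0, the form strictly decreases in s at x. *)
Lemma isotropic_decreases s s' (x : 'rV[R]_n) : 0 < s -> s < s' -> x != 0 ->
  bil (sphmx s) x x = 0 -> bil (sphmx s') x x < 0.
Proof.
rewrite !bil_sphmx => s0 ss' /bil1_gt0 p h.
have b0 : 0 < bil nonadj x x by nra.
nra.
Qed.

Lemma psd_on_hyperplane_le s s' x : 0 <= s -> psd_on_hyperplane s' ->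
  singular_on_hyperplane s x -> s' <= s.
Proof.
move=> s_ge0 ps' sx; have s0 := singular_gt0 s_ge0 sx; case: sx => x0 xo hx.
rewrite leNgt; apply/negP => ss'.
have := isotropic_decreases s0 ss' x0 (hx x xo).
by rewrite ltNge ps'.
Qed.

(** The pencil is restricted to the hyperplane through a basis N of it, so that
    the degeneration of semidefinite pencils applies to N A(s) N^T. *)
Lemma hyperplane_degenerates s1 : 0 <= s1 -> ~ psd_on_hyperplane s1 ->
  exists s x, [/\ 0 < s, s < s1 & singular_on_hyperplane s x].
Proof.
move=> s1_ge0 np.
pose N := row_base (kermx ones).
have No m (y : 'M_(m, _)) : y *m N *m ones = 0.
  by apply/sub_kermxP; apply: submx_trans (submxMl _ _) _; rewrite eq_row_base.
pose A0 := N *m 1%:M *m N^T; pose B0 := N *m nonadj *m N^T.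
have AB s : A0 - s *: B0 = N *m sphmx s *m N^T.
  by rewrite mulmxBr mulmxBl -scalemxAr -scalemxAl.
have sA : A0^T = A0 by rewrite trmx_congr trmx1.
have sB : B0^T = B0 by rewrite trmx_congr nonadj_sym.
have pA : psd A0 by move=> x; rewrite bil_congr bil1_ge0.
have [ps|s [s0 ss1 _ [y y0]]] := pencil_degenerates sA sB pA s1_ge0.
  apply: np => x xo; have xN : (x <= N)%MS by rewrite eq_row_base; apply/sub_kermxP.
  by have := ps (x *m pinvmx N); rewrite AB bil_congr mulmxKpV.
rewrite AB => hy; have sg : singular_on_hyperplane s (y *m N).
  split; [|exact: No|].
    by rewrite mulmx_free_eq0 // row_base_free.
  move=> z zo; have zN : (z <= N)%MS by rewrite eq_row_base; apply/sub_kermxP.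
  by rewrite -(mulmxKpV zN) -bil_congr /bil hy mul0mx mxE.
by exists s, (y *m N); split => //; apply: singular_gt0 sg.
Qed.

(** * Orders of vanishing and kernels *)

Lemma sphmx_anisotropic s (x : 'rV[R]_n) : bil (sphmx s) x x = 0 ->
  bil nonadj x x = 0 -> x = 0.
Proof. by rewrite bil_sphmx => + h; rewrite h mulr0 subr0; apply: bil1_eq0. Qed.

Lemma mup_detMC t : Defs.detM R G + detC R G != 0 /\
  mup t (Defs.detM R G + detC R G) = \rank (kermx (sphmx (t - 1))).
Proof.
rewrite (detMC_pencil t).
have [|x|->->] := @mup_det_pencil R n (- sphmx (t - 1)) nonadj t.
- by rewrite linearN /= sphmx_sym.
- rewrite mulmxN => /eqP; rewrite oppr_eq0 => /eqP h; apply: (@sphmx_anisotropic (t - 1)).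
  by rewrite /bil h mul0mx mxE.
- by split=> //; rewrite !mxrank_ker mxrank_opp.
Qed.

Lemma mup_detC t : detC R G != 0 /\
  mup t (detC R G) = \rank (kermx (bordmx (t - 1))).
Proof.
rewrite (detC_pencil t); apply: mup_det_pencil.
  rewrite /bordmx tr_block_mx trmx0 trmxK linearB /= sphmx_sym.
  by rewrite trmx_mul trmxK.
move=> v; rewrite -[v]hsubmxK => /bordmx_kernel[xo cx].
rewrite mul_row_block !mulmx0 !addr0 tr_row_mx mul_row_col mul0mx !add0r => h.
have x0 : rsubmx v = 0.
  apply: (@sphmx_anisotropic (t - 1)) => //.
  by rewrite /bil cx -mulmxA -trmx_mul xo trmx0 mulmx0 mxE.
move: cx; rewrite x0 mul0mx => /esym/mulmx_ones_eq0 ->.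
by rewrite row_mx0.
Qed.

Definition zero_pad : 'M[R]_(n, 1 + n) := row_mx 0 1%:M.

Lemma zero_pad_free : row_free zero_pad.
Proof.
apply/row_freeP; exists (col_mx 0 1%:M).
by rewrite mul_row_col mul0mx mul1mx add0r.
Qed.

Lemma mulmx_zero_pad m (x : 'M_(m, n)) : x *m zero_pad = row_mx 0 x.
Proof. by rewrite mul_mx_row mulmx0 mulmx1. Qed.

(** For semidefinite A, the x-part of a Cayley-Menger kernel vector is isotropic,
    hence in ker A, and this forces c = 0. The kernel counted by C_G is therefore
    the sum-zero part of ker A, from which y is missing. *)
Lemma mup_lt_of_psd t y : psd (sphmx (t - 1)) -> y *m sphmx (t - 1) = 0 ->
  y *m ones = 1%:M -> (mup t (detC R G) < mup t (Defs.detM R G + detC R G))%N.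
Proof.
move=> pA yA yo; have [_ ->] := mup_detC t; have [_ ->] := mup_detMC t.
set K := kermx (sphmx _).
have sK : (kermx (bordmx (t - 1)) <= (K :&: kermx ones)%MS *m zero_pad)%MS.
  apply/row_subP => i; have /sub_kermxP := row_sub i (kermx (bordmx (t - 1))).
  move: (row _ _) => v; rewrite -[v]hsubmxK => /bordmx_kernel[xo cx].
  have xA : rsubmx v *m sphmx (t - 1) = 0.
    apply: psd_isotropic => //; first exact: sphmx_sym.
    by rewrite /bil cx -mulmxA -trmx_mul xo trmx0 mulmx0 mxE.
  move: cx; rewrite xA => /esym/mulmx_ones_eq0 ->.
  rewrite -mulmx_zero_pad submxMr // sub_capmx; apply/andP.
  by split; apply/sub_kermxP.
apply: leq_ltn_trans (mxrankS sK) _.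
apply: leq_ltn_trans (mxrankM_maxl _ _) _.
rewrite -(mxrank_mul_ker K ones) -[X in (X < _)%N]add0n ltn_add2r lt0n mxrank_eq0.
apply/eqP => Ko; have yK : (y <= K)%MS by apply/sub_kermxP.
move: yo; have [D ->] := submxP yK; rewrite -mulmxA Ko mulmx0 => /matrixP/(_ 0 0).
by rewrite !mxE => /eqP; rewrite eq_sym oner_eq0.
Qed.

(** If every vector of ker A had sum zero, padding by a 0 would embed ker A in
    the kernel of the Cayley-Menger matrix. *)
Lemma kernel_of_mup_lt t : (mup t (detC R G) < mup t (Defs.detM R G + detC R G))%N ->
  exists2 y : 'rV[R]_n, y *m sphmx (t - 1) = 0 & y *m ones = 1%:M.
Proof.
have [_ ->] := mup_detC t; have [_ ->] := mup_detMC t => lt_ker.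
set K := kermx (sphmx (t - 1)) in lt_ker *.
have Ko : K *m ones != 0.
  apply: contraL lt_ker => /eqP Ko; rewrite -leqNgt.
  rewrite -(mxrankMfree _ zero_pad_free); apply: mxrankS; apply/sub_kermxP.
  rewrite mulmx_zero_pad mul_row_block !mul0mx !add0r mulmxBr mulmxA Ko mul0mx mulmx_ker subrr.
  by rewrite row_mx0.
have [i Ki] : exists i, (row i K *m ones) 0 0 != 0.
  apply: contrapT => nK; move/eqP: Ko; apply; apply/row_matrixP => i.
  rewrite row_mul row0; apply/rowP => j; rewrite ord1 [RHS]mxE; apply/eqP.
  by apply: contrapT => h; apply: nK; exists i; apply/negP.
exists (((row i K *m ones) 0 0)^-1 *: row i K).
  by rewrite -scalemxAl (sub_kermxP (row_sub i K)) scaler0.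
rewrite -scalemxAl; apply/rowP => j; rewrite ord1.
by rewrite [LHS]mxE mulVf // mxE.
Qed.

End Graph.

(** * Representations *)

Section Reps.
Variables (R : realType) (n : nat) (G : sgraph n).
Local Notation A := (@sphmx R n G).
Local Notation ones := (ones R n).

Lemma enorm_sqr d (x : 'rV[R]_d) : enorm x ^+ 2 = bil 1%:M x x.
Proof.
rewrite /enorm sqr_sqrtr ?bil1E; first by apply: eq_bigr => i _; rewrite expr2.
by rewrite sumr_ge0 // => i _; rewrite sqr_ge0.
Qed.

Lemma enorm_eq d (x : 'rV[R]_d) c : 0 <= c -> bil 1%:M x x = c ^+ 2 -> enorm x = c.
Proof.
move=> c0; rewrite -enorm_sqr => /eqP; rewrite eqrXn2 ?sqrtr_ge0 //.
by move/eqP.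
Qed.

Lemma bil1_sub d (x y : 'rV[R]_d) : bil 1%:M (x - y) (x - y) =
  bil 1%:M x x + bil 1%:M y y - 2 * bil 1%:M x y.
Proof.
rewrite bilDl !bilDr -[- y]scaleN1r !bilZl !bilZr (bilC y x (trmx1 _ _)); ring.
Qed.

Lemma gramE d (F : 'M[R]_(n, d)) i j : (F *m F^T) i j = bil 1%:M (row i F) (row j F).
Proof.
by rewrite bil1E mxE; apply: eq_bigr => k _; rewrite !mxE.
Qed.

(** A spherical representation is a Gram factorization of A s. The kernel
    vector of sum 1 writes the origin as an affine combination of the points, so
    that linear spanning becomes affine spanning. *)
Lemma Jspherical_of_kernel s y : 0 <= s -> psd (A s) -> y *m A s = 0 ->
  y *m ones = 1%:M -> has_Jspherical_rep R G (\rank (A s)).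
Proof.
move=> s0 psA yA yo.
have [F EF] := psd_gram_le (sphmx_sym G s) psA (leqnn _).
have rF : row_full F by rewrite /row_full -rank_gram -EF.
have g i j : bil 1%:M (row i F) (row j F) = A s i j by rewrite -gramE -EF.
have yF : y *m F = 0 by apply: gram_ker; rewrite -EF.
have dist u v : bil 1%:M (row u F - row v F) (row u F - row v F) = 2 - 2 * A s u v.
  by rewrite bil1_sub !g !sphmxE !eqxx; ring.
have s2 : Num.sqrt 2 ^+ 2 = 2 :> R by rewrite sqr_sqrtr.
have s2s : Num.sqrt (2 + 2 * s) ^+ 2 = 2 + 2 * s by rewrite sqr_sqrtr //; lra.
exists (Num.sqrt (2 + 2 * s)), (fun i => row i F); split.
- split.
  + move=> u v uv; have := dist u v; rewrite uv subrr /bil !mul0mx mxE sphmxE.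
    by case: eqVneq => //; case: ifP => _ _ ?; exfalso; lra.
  + by rewrite sqrtr_gt0.
  + by rewrite ler_sqrt; lra.
  + move=> u v uv; apply: enorm_eq; first exact: sqrtr_ge0.
    rewrite dist sphmxE uv s2; case: eqVneq uv => [->|_ _]; first by rewrite adj_irrefl.
    by rewrite mulr0 subr0.
  + move=> u v uv nuv; apply: enorm_eq; first exact: sqrtr_ge0.
    by rewrite dist sphmxE (negPf uv) (negPf nuv) s2s; ring.
- move=> x; have /row_fullP[P PF] := rF.
  pose w := x *m P; pose c := w + (1 - (w *m ones) 0 0) *: y.
  exists (fun i => c 0 i); split.
    transitivity ((c *m ones) 0 0).
      by rewrite mxE; apply: eq_bigr => i _; rewrite [X in _ = _ * X]mxE mulr1.
    by rewrite mulmxDl -scalemxAl yo !mxE eqxx mulr1; ring.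
  rewrite -mulmx_sum_row mulmxDl -scalemxAl yF scaler0 addr0.
  by rewrite -mulmxA PF mulmx1.
- by move=> u; apply: enorm_eq; rewrite // g sphmxE eqxx expr1n.
Qed.

Lemma kernel_of_Jspherical d : has_Jspherical_rep R G d -> exists s y,
  [/\ 0 <= s, psd (A s), y *m A s = 0, y *m ones = 1%:M & d = \rank (A s)].
Proof.
move=> [b [f [[injf _ ab fa fb] span sph]]].
pose F : 'M[R]_(n, d) := \matrix_i f i.
have b0 : 0 <= b by apply: le_trans ab; apply: sqrtr_ge0.
have b2 : 2 <= b ^+ 2.
  have -> : 2 = Num.sqrt 2 ^+ 2 :> R by rewrite sqr_sqrtr.
  by rewrite lerXn2r ?nnegrE ?sqrtr_ge0.
have EF : A (b ^+ 2 / 2 - 1) = F *m F^T.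
  apply/matrixP => i j; rewrite gramE !rowK sphmxE.
  have sp u : bil 1%:M (f u) (f u) = 1 by rewrite -enorm_sqr sph expr1n.
  have := bil1_sub (f i) (f j); rewrite !sp -enorm_sqr.
  case: eqVneq => [->|ij]; first by rewrite sp.
  case: ifP => [/fa ->|/negbT nij]; first by rewrite sqr_sqrtr //; lra.
  rewrite fb //; lra.
have rF : \rank F = d.
  apply/eqP; rewrite eqn_leq rank_leq_col -[X in (X <= _)%N](mxrank1 R d).
  apply: mxrankS; apply/row_subP => i; have [c [_ ->]] := span (row i 1%:M).
  apply: summx_sub => j _; apply: scalemx_sub.
  by rewrite (_ : f j = row j F) ?row_sub // rowK.
(* The affine combination giving the origin is the kernel vector of sum 1. *)
have [c [c1 c0]] := span 0.
exists (b ^+ 2 / 2 - 1), (\row_i c i); split.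
- by rewrite subr_ge0 ler_pdivlMr // mul1r.
- by rewrite EF; apply: psd_mul_tr.
- rewrite EF mulmxA (_ : _ *m F = 0) ?mul0mx // mulmx_sum_row [RHS]c0.
  by apply: eq_bigr => i _; rewrite mxE rowK.
- apply/matrixP => i j; rewrite !ord1 !mxE eqxx -[RHS]c1.
  by apply: eq_bigr => k _; rewrite !mxE mulr1.
- by rewrite EF rank_gram.
Qed.

Lemma Jspherical_euclidean d : has_Jspherical_rep R G d -> has_euclidean_rep R G d.
Proof. by move=> [b [f [rep _ _]]]; exists (Num.sqrt 2), b, f. Qed.

(** On sum-zero vectors the squared-distance matrix is -2 times the Gram matrix:
    the contributions of the squared norms g and of J have an all-ones factor
    and disappear. *)
Lemma form_of_euclidean d : has_euclidean_rep R G d -> exists s (F : 'M[R]_(n, d)) k,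
  [/\ 0 <= s, 0 < k & forall x z, x *m ones = 0 -> z *m ones = 0 ->
    bil (A s) x z = k * bil 1%:M (x *m F) (z *m F)].
Proof.
move=> [a [b [f [injf a0 ab fa fb]]]].
pose F : 'M[R]_(n, d) := \matrix_i f i.
have a2 : 0 < a ^+ 2 by rewrite exprn_gt0.
have ab2 : a ^+ 2 <= b ^+ 2 by rewrite lerXn2r ?nnegrE //; lra.
exists (b ^+ 2 / a ^+ 2 - 1), F, (2 / a ^+ 2); split.
- by rewrite subr_ge0 ler_pdivlMr // mul1r.
- by rewrite divr_gt0.
move=> x z xo zo; set s := _ - 1.
pose g : 'cV[R]_n := \col_i bil 1%:M (f i) (f i).
have E (M : 'M_n) : (forall i j, M i j = bil 1%:M (f i) (f j)) -> A s = ones *m ones^T +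
    (a ^+ 2)^-1 *: (2 *: M - g *m ones^T - ones *m g^T).
  move=> ME; apply/matrixP => i j; rewrite sphmxE !mxE !big_ord1 !mxE ME !mulr1 mul1r.
  transitivity (1 - (a ^+ 2)^-1 * enorm (f i - f j) ^+ 2); last first.
    by rewrite enorm_sqr bil1_sub; ring.
  case: eqVneq => [->|ij].
    by rewrite subrr enorm_sqr /bil !mul0mx mxE mulr0 subr0.
  case: ifP => [/fa ->|/negbT nij]; first by rewrite mulVf ?subrr // gt_eqF.
  by rewrite fb // /s; field; rewrite gt_eqF.
have hz (u : 'rV_1) : u *m ones^T *m z^T = 0.
  by rewrite -mulmxA -trmx_mul zo trmx0 mulmx0.
have -> : bil (A s) x z = (a ^+ 2)^-1 * (2 * bil (F *m F^T) x z).
  rewrite {1}/bil (E (F *m F^T)) => [|i j]; last by rewrite gramE !rowK.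
  rewrite mulmxDr mulmxA xo mul0mx add0r -scalemxAr -scalemxAl.
  rewrite !mulmxBr !mulmxBl !mulmxA xo !mul0mx subr0 hz subr0.
  by rewrite -scalemxAr -scalemxAl !mulmxA mxE mxE /bil !mulmxA.
by rewrite /bil mulmx1 trmx_mul !mulmxA; field; rewrite gt_eqF.
Qed.

End Reps.

(** * The value of the circumradius function at its first critical parameter *)

(** Cancelling the gcd lowers the orders of q and p + q at t equally, so it
    suffices to treat coprime p and q: there p + q vanishes to a higher order
    exactly when it vanishes and q does not, a common root being excluded. *)
Lemma reduced_fraction_eqN1 (K : fieldType) (p q : {poly K}) (t : K) :
  q != 0 -> p + q != 0 ->
  (~~ root (q %/ gcdp p q) t /\
    (p %/ gcdp p q).[t] = - (q %/ gcdp p q).[t]) <->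
  (mup t q < mup t (p + q))%N.
Proof.
move=> q0 pq0; set g := gcdp p q; set p' := p %/ g; set q' := q %/ g.
have Ep : p = p' * g by rewrite divpK // dvdp_gcdl.
have Eq : q = q' * g by rewrite divpK // dvdp_gcdr.
have Epq : p + q = (p' + q') * g by rewrite mulrDl -Ep -Eq.
have g0 : g != 0 by rewrite gcdp_eq0 negb_and q0 orbT.
have q'0 : q' != 0 by apply: contraNneq q0 => z; rewrite Eq z mul0r.
have pq'0 : p' + q' != 0 by apply: contraNneq pq0 => z; rewrite Epq z mul0r.
rewrite Epq [in mup t q]Eq !mupM // ltn_add2r.
have rmup (r : {poly K}) : r != 0 -> root r t = (0 < mup t r)%N.
  by move=> r0; rewrite -XsubC_dvd // dvdp_XsubCl.
split=> [[rq e]|lt_mup].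
  by rewrite (mupNroot rq) -rmup // rootE hornerD e addNr.
have : root (p' + q') t by rewrite rmup //; apply: leq_ltn_trans lt_mup.
rewrite rootE hornerD addr_eq0 => /eqP e; split=> //.
apply/negP => rq; have co : coprimep q' p'.
  by rewrite coprimep_sym coprimep_div_gcd // q0 orbT.
by have := coprimep_root co rq; rewrite e (rootP rq) oppr0 eqxx.
Qed.

Section Main.
Variables (R : realType) (n : nat) (G : sgraph n).
Local Notation A := (@sphmx R n G).
Local Notation ones := (ones R n).

Lemma tau1_eq (t : R) : is_smallest_root_gt1 G t -> tau1 R G = t%:E.
Proof.
move=> [rt t1 mt]; apply: xget_unique; first by exists t.
move=> _ [s [rs s1 ms] <-]; congr _%:E.
by apply/eqP; rewrite eq_le mt // ms.
Qed.

Lemma ratF_half (t : R) : detC R G != 0 -> Defs.detM R G + detC R G != 0 ->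
  ratF G t = (1 / 2)%:E <-> (mup t (detC R G) < mup t (Defs.detM R G + detC R G))%N.
Proof.
move=> C0 MC0; rewrite -reduced_fraction_eqN1 // /ratF -/(redC R G) -/(redM R G).
case: ifP => rC; split => [|[]] //.
  move=> [h]; split => //; move/negbT: rC; rewrite rootE => c0.
  have : (redM R G).[t] / (redC R G).[t] = -1 by lra.
  by move=> /(canRL (mulfVK c0)) ->; rewrite mulN1r.
move=> _ ->; congr _%:E; field; by move/negbT: rC; rewrite rootE.
Qed.

Lemma calR_half : calR R G = (1 / Num.sqrt 2)%:E <->
  exists2 t, is_smallest_root_gt1 G t & ratF G t = (1 / 2 : R)%:E.
Proof.
have s2 : (1 / Num.sqrt 2) ^+ 2 = 1 / 2 :> R.
  by rewrite expr_div_n expr1n sqr_sqrtr.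
split=> [|[t st rt]]; last first.
  rewrite /calR (tau1_eq st) rt; congr _%:E.
  by rewrite -s2 sqrtr_sqr ger0_norm // divr_ge0 // sqrtr_ge0.
rewrite /calR /tau1.
case: xgetP => [_ -> [t st <-]|_] //.
move E : (ratF G t) => [r| |] // [h]; exists t => //; rewrite E; congr _%:E.
rewrite -s2 -h sqr_sqrtr // leNgt; apply/negP => r0.
move: h; rewrite ler0_sqrtr ?ltW // => h.
by have := s2; rewrite -h expr0n /=; lra.
Qed.

(** * Comparison of the two dimensions *)

Lemma sum_one_neq0 (y : 'rV[R]_n) : y *m ones = 1%:M -> y != 0.
Proof.
move=> yo; apply/eqP => y0; move: yo; rewrite y0 mul0mx => /matrixP/(_ 0 0)/eqP.
by rewrite !mxE eq_sym oner_eq0.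
Qed.

Lemma bil_ker s (y z : 'rV[R]_n) : y *m A s = 0 -> bil (A s) y z = 0.
Proof. by move=> h; rewrite /bil h mul0mx mxE. Qed.

Lemma kernel_gt0 s (y : 'rV[R]_n) : 0 <= s -> y *m A s = 0 ->
  y *m ones = 1%:M -> 0 < s.
Proof.
move=> s0 yA yo; rewrite lt_def s0 andbT; apply/eqP => sz.
by have := sum_one_neq0 yo; rewrite -[y]mulmx1 -(sphmx0 R G) -sz yA eqxx.
Qed.

Lemma psd_parameter_le s s' y : 0 <= s -> y *m A s = 0 ->
  y *m ones = 1%:M -> psd (A s') -> s' <= s.
Proof.
move=> s0 yA yo ps'; have s_gt0 := kernel_gt0 s0 yA yo.
rewrite leNgt; apply/negP => ss'.
have := isotropic_decreases s_gt0 ss' (sum_one_neq0 yo) (bil_ker y yA).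
by rewrite ltNge ps'.
Qed.

(** Spherical representations at two different parameters exclude each other:
    the kernel vector of the smaller one would be negative for the larger one. *)
Lemma dim2J_eq s y : 0 <= s -> psd (A s) -> y *m A s = 0 ->
  y *m ones = 1%:M -> dim2J R G = \rank (A s).
Proof.
move=> s0 ps yA yo; apply: xget_unique; first exact: Jspherical_of_kernel ps yA yo.
move=> d /kernel_of_Jspherical [s' [y' [s0' ps' yA' yo' ->]]].
suff -> : s' = s by [].
apply/eqP; rewrite eq_le (psd_parameter_le s0 yA yo ps').
by rewrite (psd_parameter_le s0' yA' yo' ps).
Qed.

(** The kernel vector y complements the hyperplane, and adding a multiple of y to
    a vector does not change the value of the form. *)
Lemma psd_of_kernel s y : psd_on_hyperplane G s -> y *m A s = 0 ->
  y *m ones = 1%:M -> psd (A s).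
Proof.
move=> ps yA yo x; pose c := (x *m ones) 0 0.
have ho : (x - c *: y) *m ones = 0.
  by rewrite mulmxBl -scalemxAl yo; apply/rowP => j; rewrite ord1 !mxE eqxx mulr1 /c mxE subrr.
have := ps _ ho; rewrite bilDl !bilDr -scaleNr !bilZl !bilZr.
by rewrite (bilC x y (sphmx_sym G s)) !(bil_ker _ yA) !mulr0 !addr0.
Qed.

(** Two independent kernel vectors combine to one of sum zero. *)
Lemma hyperplane_kernel s : (\rank (A s) < n - 1)%N ->
  exists2 x : 'rV[R]_n, x != 0 & x *m A s = 0 /\ x *m ones = 0.
Proof.
move=> rA; pose K := kermx (A s).
have rK : (1 < \rank K)%N by rewrite mxrank_ker; lia.
have : (K :&: kermx ones)%MS != 0.
  rewrite -mxrank_eq0; have := mxrank_mul_ker K ones; have := rank_leq_col (K *m ones); lia.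
case/rowV0Pn => x; rewrite sub_capmx => /andP[/sub_kermxP xA /sub_kermxP xo] x0.
by exists x.
Qed.

Section Roots.
Hypothesis n_gt0 : (0 < n)%N.

Lemma is_smallest_root_psd (s : R) x : 0 <= s -> psd_on_hyperplane G s ->
  singular_on_hyperplane G s x -> is_smallest_root_gt1 G (1 + s).
Proof.
move=> s0 ps sx; have s_gt0 := singular_gt0 s0 sx.
have E : 1 + s - 1 = s by rewrite addrC addKr.
split; [|by rewrite ltrDl|].
  by apply/(root_detC G n_gt0 _); exists x; rewrite E.
move=> r /(root_detC G n_gt0 _)[z sz] r1; rewrite addrC -lerBrDr.
by apply: psd_on_hyperplane_le ps sz; rewrite subr_ge0 ltW.
Qed.

(** Otherwise the form would have degenerated on the hyperplane earlier, giving a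
    root of C_G between 1 and t. *)
Lemma psd_on_hyperplane_tau (t : R) : is_smallest_root_gt1 G t ->
  psd_on_hyperplane G (t - 1).
Proof.
move=> [_ t1 mt]; apply: contrapT => np.
have t1_ge0 : 0 <= t - 1 by rewrite subr_ge0 ltW.
have [s [x [s0 st sx]]] := hyperplane_degenerates t1_ge0 np.
have : t <= 1 + s.
  apply: mt; last by rewrite ltrDl.
  by apply/(root_detC G n_gt0 _); exists x; rewrite addrC addKr.
by rewrite leNgt; move/negP; apply; rewrite -ltrBrDl.
Qed.

(** The parameter s of the representation is at most t - 1. If it is smaller, the
    form is nondegenerate on the hyperplane, so n - 1 dimensions are needed. If it
    is t - 1, the projection onto the hyperplane along y preserves the whole form
    A, which therefore factors through the d coordinates. *)
Lemma euclidean_rank_le (t : R) y d : is_smallest_root_gt1 G t ->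
  y *m A (t - 1) = 0 -> y *m ones = 1%:M ->
  has_euclidean_rep R G d -> (\rank (A (t - 1)) <= d)%N.
Proof.
move=> [rt t1 mt] yA yo /form_of_euclidean [s [F [k [s0 k0 hF]]]].
have ps : psd_on_hyperplane G s.
  by move=> x xo; rewrite hF // mulr_ge0 ?bil1_ge0 // ltW.
have st : s <= t - 1.
  have [x sx] := (root_detC G n_gt0 t).1 rt.
  by apply: psd_on_hyperplane_le ps sx; rewrite subr_ge0 ltW.
have [se|sne] := eqVneq s (t - 1).
  rewrite -se in yA *; pose P : 'M[R]_n := 1%:M - ones *m y.
  have Po (x : 'rV_n) : x *m P *m ones = 0.
    by rewrite -mulmxA mulmxBl mul1mx -mulmxA yo mulmx1 subrr mulmx0.
  have PA : P *m A s *m P^T = A s.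
    rewrite /P mulmxBl mul1mx -mulmxA yA mulmx0 subr0 linearB /= trmx1 mulmxBr.
    rewrite mulmx1 trmx_mul mulmxA -[A s *m y^T]trmxK trmx_mul trmxK sphmx_sym yA.
    by rewrite trmx0 mul0mx subr0.
  apply: leq_trans (rank_leq_col (P *m F)).
  have sK : (kermx (P *m F) <= kermx (A s))%MS.
    apply/row_subP => i; apply/sub_kermxP/bil_ext => z.
    have /sub_kermxP := row_sub i (kermx (P *m F)); move: (row _ _) => x xPF.
    rewrite -PA bil_congr hF // /bil mulmx1 -(mulmxA x) xPF mul0mx mxE mulr0 //.
  have := mxrankS sK; rewrite !mxrank_ker.
  have := rank_leq_row (A s); have := rank_leq_row (P *m F); lia.
(* With fewer than n - 1 coordinates some nonzero sum-zero x satisfies x F = 0, so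
   that the form degenerates already at s. *)
have rA : (\rank (A (t - 1)) < n)%N.
  rewrite ltn_neqAle rank_leq_row andbT; apply/negP => fA.
  have := sum_one_neq0 yo; rewrite -(mulmx_free_eq0 _ fA) ?yA ?eqxx //.
rewrite leqNgt; apply/negP => dn.
have : kermx (row_mx F ones) != 0.
  by rewrite -mxrank_eq0 mxrank_ker; have := rank_leq_col (row_mx F ones); lia.
case/rowV0Pn => x /sub_kermxP/eqP; rewrite mul_mx_row row_mx_eq0.
case/andP => /eqP xF /eqP xo x0.
have sx : singular_on_hyperplane G s x.
  by split=> // z zo; rewrite hF // xF /bil !mul0mx mxE mulr0.
have := (is_smallest_root_psd s0 ps sx).
case=> rs s1 _; have := mt _ rs s1; rewrite addrC -lerBlDr => ts.
by move: sne; rewrite eq_le st ts.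
Qed.

End Roots.

Hypothesis G_neq_Kn : ~ is_complete G.

Lemma nonadjacent_pair : exists u v, u != v /\ ~~ adj G u v.
Proof.
apply: contrapT => h; apply: G_neq_Kn => u v.
have [->|uv] := eqVneq u v; first by rewrite adj_irrefl.
by apply: contrapT => /negP nuv; apply: h; exists u, v.
Qed.

(** At e_u + e_v, for a nonadjacent pair, the form of A(s) is 2 - 2 s. *)
Lemma not_psd_sphmx2 : ~ psd (A 2).
Proof.
have [u [v [uv nuv]]] := nonadjacent_pair => ps.
have := ps (delta_mx 0 u + delta_mx 0 v).
rewrite bilDl !bilDr !bil_delta -!rowE ![row _ _ _ _]mxE !sphmxE !eqxx.
have vu : (v == u) = false by rewrite eq_sym (negPf uv).
have nvu : adj G v u = false by rewrite adj_sym (negPf nuv).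
rewrite (negPf uv) vu (negPf nuv) nvu; lra.
Qed.

(** Perron-Frobenius: replacing the entries of a kernel vector by their absolute
    values cannot increase the form, so it stays in the kernel, and its sum is
    then positive. *)
Lemma spherical_kernel_exists : exists s y,
  [/\ 0 <= s, psd (A s), y *m A s = 0 & y *m ones = 1%:M].
Proof.
have psd1 : psd (1%:M : 'M[R]_n) by move=> x; apply: bil1_ge0.
have [s [s0 _ ps [x x0 xA]]] := pencil_degenerates (trmx1 _ _) (nonadj_sym _ G)
  psd1 (ler0n R 2) not_psd_sphmx2.
rewrite -/(A s) in ps xA.
pose w : 'rV[R]_n := \row_i `|x 0 i|.
have wA : w *m A s = 0.
  apply: psd_isotropic => //; first exact: sphmx_sym.
  apply/eqP; rewrite eq_le ps andbT.
  have <- : bil (A s) x x = 0 by rewrite /bil xA mul0mx mxE.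
  rewrite !bil_sphmx lerB //.
    by rewrite !bil1E; apply: ler_sum => i _; rewrite !mxE -normrM ger0_norm // -expr2 sqr_ge0.
  apply: ler_wpM2l => //; rewrite !bilE; apply: ler_sum => i _; apply: ler_sum => j _.
  rewrite !mxE; apply: le_trans (ler_norm _) _.
  by rewrite !normrM [`|_%:R|]ger0_norm.
have wo : w *m ones = (\sum_i `|x 0 i|)%:M.
  apply/rowP => j; rewrite ord1 !mxE eqxx; apply: eq_bigr => i _.
  by rewrite !mxE mulr1.
have S0 : \sum_i `|x 0 i| != 0.
  apply: contra x0; rewrite psumr_eq0 // => /allP h; apply/eqP/rowP => i.
  by have := h i (mem_index_enum i); rewrite normr_eq0 mxE => /eqP.
exists s, ((\sum_i `|x 0 i|)^-1 *: w); split => //.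
  by rewrite -scalemxAl wA scaler0.
by rewrite -scalemxAl wo scale_scalar_mx mulVf.
Qed.

End Main.

Theorem theorem4p3 (R : realType) (n : nat) (G : sgraph n)
    (G_neq_Kn : ~ is_complete G) :
  (calR R G = (1 / Num.sqrt 2)%:E -> dim2J R G = dim2E R G) /\
  (((1 / Num.sqrt 2)%:E < calR R G)%E -> dim2J R G = (n - 1)%N).
Proof.
have [u _] := nonadjacent_pair G_neq_Kn.
have n_gt0 : (0 < n)%N := leq_ltn_trans (leq0n u) (ltn_ord u).
have C0 : detC R G != 0 := (mup_detC G n_gt0 0).1.
have MC0 : Defs.detM R G + detC R G != 0 := (mup_detMC G 0).1.
split.
  case/calR_half => t st /(ratF_half t C0 MC0)/(kernel_of_mup_lt n_gt0)[y yA yo].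
  have [_ t1 _] := st; have s0 : 0 <= t - 1 by rewrite subr_ge0 ltW.
  have psA := psd_of_kernel (psd_on_hyperplane_tau n_gt0 st) yA yo.
  rewrite (dim2J_eq s0 psA yA yo); apply/esym/xget_unique.
    split; first exact/Jspherical_euclidean/(Jspherical_of_kernel s0 psA yA yo).
    by move=> d; apply: (euclidean_rank_le n_gt0 st yA yo).
  move=> d [repd mind]; apply/eqP; rewrite eqn_leq mind; last first.
    exact/Jspherical_euclidean/(Jspherical_of_kernel s0 psA yA yo).
  by rewrite (euclidean_rank_le n_gt0 st yA yo).
move=> ltR; have [s [y [s0 psA yA yo]]] := spherical_kernel_exists R G_neq_Kn.
rewrite (dim2J_eq s0 psA yA yo).
have [rA|rA|//] := ltngtP (\rank (sphmx G s)) (n - 1)%N.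
  have [x x0 [xA xo]] := hyperplane_kernel rA.
  have sx : singular_on_hyperplane G s x by split => // z _; apply: bil_ker.
  have st := is_smallest_root_psd n_gt0 s0 (fun x _ => psA x) sx.
  have es : 1 + s - 1 = s by rewrite addrC addKr.
  have : calR R G = (1 / Num.sqrt 2)%:E.
    apply/calR_half; exists (1 + s) => //; apply/(ratF_half _ C0 MC0).
    by apply: (mup_lt_of_psd n_gt0 (y := y)); rewrite ?es.
  by move=> e; rewrite e ltxx in ltR.
have fA : \rank (sphmx G s) = n by have := rank_leq_row (sphmx G s); lia.
have := sum_one_neq0 yo.
by rewrite -(mulmx_free_eq0 y (introT eqP fA)) yA eqxx.
Qed.
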